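(* Let $G$ be the complete sun graph on $2n$ vertices ($n\ge 3$). Then \[\varphi(G^2)=\begin{cases} n^2+1 & \text{if } n \text{ is odd},\\ \frac{n}{2}(2n-1) & \text{if } n \text{ is even}.\end{cases}\]
   Context: All graphs are simple and finite. An $n$-sun ($n\ge3$) is a chordal graph on $2n$ vertices whose vertex set is partitioned into $U=\{u_1,\dots,u_n\}$ and $W=\{w_1,\dots,w_n\}$ such that $W$ is an independent set and $w_j$ is adjacent to $u_i$ if and only if $j=i$ or $j\equiv i+1 \pmod n$. A complete sun is a sun in which the induced subgraph on $U$ is complete. $\mathbb{N}_0$ denotes the set of non-negative integers. For non-empty $A,B\subseteq\mathbb{N}_0$, $A+B=\{a+b: a\in A, b\in B\}$. An integer additive set-indexer (IASI) of a graph $G$ is an injective function $f:V(G)\to\mathcal{P}(\mathbb{N}_0)$ with non-empty values such that the induced map $f^+(uv)=f(u)+f(v)$ on $E(G)$ is also injective. An IASI is weak if $|f^+(uv)|=\max(|f(u)|,|f(v)|)$ for every edge $uv$. An element (vertex or edge) is mono-indexed if its set-label has cardinality $1$. The sparing number $\varphi(H)$ of a graph $H$ is the minimum number of mono-indexed edges over all weak IASIs of $H$. The square $G^2$ of $G$ has vertex set $V(G)$, two distinct vertices adjacent iff their distance in $G$ is at most $2$.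
   Formalization: The set-labels of an IASI are taken to be finite non-empty subsets of the non-negative integers; if infinite labels were allowed, every edge could carry an infinite label and the sparing number would be 0. *)

(* Defs.v *)
From mathcomp Require Import all_boot finmap.

Set Implicit Arguments.
Unset Strict Implicit.
Unset Printing Implicit Defensive.

Local Open Scope fset_scope.
Local Open Scope nat_scope.

Record sgraph := SGraph {
  vertex :> finType;
  adj : rel vertex;
  adj_sym : symmetric adj;
  adj_irrefl : irreflexive adj }.

Arguments adj {G} : rename.

Definition chordal (G : sgraph) : Prop :=
  forall c : seq G, 4 <= size c -> ucycle adj c ->
  exists x y : G, [/\ x \in c, y \in c, adj x y, y != next c x & x != next c y].

(* Indices run over 0, ..., n-1 instead of 1, ..., n; since the adjacency
   condition is stated modulo n, this only relabels the vertices. *)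
Record is_sun (n : nat) (G : sgraph) (u w : 'I_n -> G) : Prop := IsSun {
  sun_order_ge3 : 3 <= n;
  sun_chordal : chordal G;
  sun_card : #|G| = 2 * n;
  sun_inj_u : injective u;
  sun_inj_w : injective w;
  sun_disjoint : forall i j, u i != w j;
  sun_cover : forall x : G, (exists i, x = u i) \/ (exists j, x = w j);
  sun_independent : forall i j, ~~ adj (w i) (w j);
  sun_adj : forall i j, adj (w j) (u i) = (j == i) || (j == i.+1 %[mod n]) }.

Definition complete_sun (n : nat) (G : sgraph) : Prop :=
  exists u w : 'I_n -> G,
    is_sun u w /\ (forall i j, i != j -> adj (u i) (u j)).

Section Square.
Variable G : sgraph.

Definition walk (x y : G) (k : nat) : bool :=
  [exists p : k.-tuple G, path adj x p && (last x p == y)].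

Definition is_dist (x y : G) (k : nat) : bool :=
  walk x y k && [forall j : 'I_k, ~~ walk x y j].

Definition square_adj : rel G :=
  [rel x y | (x != y) && [exists k : 'I_3, is_dist x y k]].

Lemma walk_sym x y k : walk x y k = walk y x k.
Proof.
suff W a b : walk a b k -> walk b a k by apply/idP/idP; apply: W.
case/existsP => p /andP[pth /eqP lst]; apply/existsP.
have sz : size (rev (belast a p)) == k by rewrite size_rev size_belast size_tuple.
exists (Tuple sz) => /=; rewrite -lst rev_path.
rewrite (eq_path (e' := adj)) => [|s t]; last exact: adj_sym.
rewrite pth /=; case: (tval p) => [|s q] /=; first by rewrite eqxx.
by rewrite rev_cons last_rcons eqxx.
Qed.

Lemma square_adj_sym : symmetric square_adj.
Proof.
move=> x y; rewrite /square_adj /= [x == y]eq_sym; congr (_ && _); apply: eq_existsb => k.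
rewrite /is_dist walk_sym; congr (_ && _).
by apply: eq_forallb => j; rewrite walk_sym.
Qed.

Lemma square_adj_irrefl : irreflexive square_adj.
Proof. by move=> x; rewrite /square_adj /= eqxx. Qed.

Definition square : sgraph := SGraph square_adj_sym square_adj_irrefl.

End Square.

Definition sumset (A B : {fset nat}) : {fset nat} :=
  [fset a + b | a in A, b in B].

(* Set-labels are finite sets: if infinite labels were allowed, the weakness
   condition below would hold between any two of them. *)
Record is_IASI (G : sgraph) (f : G -> {fset nat}) : Prop := IsIASI {
  IASI_nonempty : forall x, f x != fset0;
  IASI_inj : injective f;
  IASI_edge_inj : forall x y x' y', adj x y -> adj x' y' ->
    sumset (f x) (f y) = sumset (f x') (f y') -> [set x; y] = [set x'; y'] }.

Definition is_weak_IASI (G : sgraph) (f : G -> {fset nat}) : Prop :=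
  is_IASI f /\
  (forall x y, adj x y -> #|` sumset (f x) (f y)| = maxn #|` f x| #|` f y|).

(* Edges are unordered pairs, so that each one is counted once. *)
Definition mono_edges (G : sgraph) (f : G -> {fset nat}) : {set {set G}} :=
  [set [set p.1; p.2] | p : G * G &
     adj p.1 p.2 && (#|` sumset (f p.1) (f p.2)| == 1)].

Definition is_sparing_number (G : sgraph) (k : nat) : Prop :=
  (exists f : G -> {fset nat}, is_weak_IASI f /\ #|mono_edges f| = k) /\
  (forall f : G -> {fset nat}, is_weak_IASI f -> k <= #|mono_edges f|).

(* Main.v *)
Require Import Defs.
From mathcomp Require Import all_boot finmap zify.

Set Implicit Arguments.
Unset Strict Implicit.
Unset Printing Implicit Defensive.

(* In a weak IASI the vertices whose labels are not singletons form an
   independent set I, and every independent set arises in this way; the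
   mono-indexed edges are those avoiding I, so their number is
   |E| - \sum_(x in I) deg x. The square of the complete n-sun is the join of K_n
   (on U) and C_n (on W): vertices of U have degree 2n - 1 and are adjacent to
   everything, vertices of W have degree n + 2, and I contains at most n./2 of
   them. Since 2n - 1 <= n./2 * (n + 2) for n >= 3, the sum is maximal when I
   consists of every other vertex of W. *)

Local Open Scope fset_scope.
Local Open Scope nat_scope.

(** * Sumsets and translates of finite sets of naturals *)

Lemma in_sumset (A B : {fset nat}) c :
  reflect (exists a b, [/\ a \in A, b \in B & c = a + b]) (c \in sumset A B).
Proof.
apply: (iffP (imfset2P _ _ _ _ _)) => [[a aA [b bB ->]] | [a [b [aA bB ->]]]].
  by exists a, b.
by exists a => //; exists b.
Qed.

Lemma sumsetC A B : sumset A B = sumset B A.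
Proof.
by apply/fsetP => c; apply/in_sumset/in_sumset => -[a [b [aA bB ->]]];
  exists b, a; rewrite addnC.
Qed.

Lemma card_translate (A : {fset nat}) b : #|` [fset a + b | a in A]| = #|` A|.
Proof. by rewrite card_imfset //= => x y /addIn. Qed.

Lemma translate_inj (A : {fset nat}) b b' :
  A != fset0 -> [fset a + b | a in A] = [fset a + b' | a in A] -> b = b'.
Proof.
move=> A0 eqA.
have sumE c : \sum_(i <- [fset a + c | a in A]) i = \sum_(a <- A) a + #|` A| * c.
  rewrite big_imfset /=; last by move=> x y _ _ /addIn.
  by rewrite big_split /= big_const_seq count_predT iter_addn_0 mulnC.
have /eqP := sumE b; rewrite eqA sumE eqn_add2l eqn_pmul2l ?cardfs_gt0 //.
by move/eqP.
Qed.

Lemma sumset1r (A : {fset nat}) b : sumset A [fset b] = [fset a + b | a in A].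
Proof.
apply/fsetP => c; apply/in_sumset/imfsetP => /= [[a [b' [aA]]] | [a aA ->]].
  by rewrite inE => /eqP -> ->; exists a.
by exists a, b; rewrite inE eqxx.
Qed.

(* Two translates of [A] have the same cardinality and differ, so together
   they have more elements than [A]. *)
Lemma card_sumset_gt (A B : {fset nat}) :
  A != fset0 -> 1 < #|` B| -> #|` A| < #|` sumset A B|.
Proof.
move=> A0 B1.
have /fset0Pn[b bB] : B != fset0 by rewrite -cardfs_gt0 ltnW.
have /fset0Pn[b'] : B `\ b != fset0.
  by rewrite -cardfs_gt0; move: B1; rewrite (cardfsD1 b) bB.
rewrite !inE => /andP[bb' b'B].
have sub c : c \in B -> [fset a + c | a in A] `<=` sumset A B.
  by move=> cB; apply/fsubsetP => _ /imfsetP[a /= aA ->]; apply/in_sumset; exists a, c.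
rewrite ltn_neqAle -{2}(card_translate A b) (fsubset_leq_card (sub b bB)) andbT.
apply: contra bb' => /eqP eqc; apply/eqP; apply: (@translate_inj A) => //.
have full c : c \in B -> [fset a + c | a in A] = sumset A B.
  by move=> cB; apply/eqP; rewrite eqEfcard sub //= card_translate eqc.
by rewrite !full.
Qed.

(** This strict inequality is what forbids an edge between two non-singleton labels in a weak
    IASI. *)
Lemma card_sumset_gt_max (A B : {fset nat}) :
  1 < #|` A| -> 1 < #|` B| -> maxn #|` A| #|` B| < #|` sumset A B|.
Proof.
move=> A1 B1; rewrite gtn_max card_sumset_gt -?cardfs_gt0 ?(ltnW A1) //=.
by rewrite sumsetC card_sumset_gt // -cardfs_gt0 ltnW.
Qed.

(** * Sums of two distinct powers of two *)

Lemma trunc_log_add_exp2 a b : a != b -> trunc_log 2 (2 ^ a + 2 ^ b) = maxn a b.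
Proof.
wlog ltab : a b / a < b => [H ab | _].
  have [lt|lt|E] := ltngtP a b; last by rewrite E eqxx in ab.
  - by rewrite H // (maxn_idPr (ltnW lt)).
  - by rewrite addnC H // 1?eq_sym // (maxn_idPr (ltnW lt)).
(* For [a < b] the sum is at least [2 ^ b] and less than [2 ^ b.+1]. *)
rewrite (maxn_idPr (ltnW ltab)); apply: trunc_log_eq => //.
by rewrite leq_addl expnS mul2n -addnn ltn_add2r ltn_exp2l.
Qed.

(** The truncated logarithm of each side is its larger exponent, so the two pairs share an exponent;
    cancelling its power identifies the other ones. *)
Lemma sum_exp2_inj a b c d : a != b -> c != d -> 2 ^ a + 2 ^ b = 2 ^ c + 2 ^ d ->
  (a = c /\ b = d) \/ (a = d /\ b = c).
Proof.
move=> ab cd E; have := trunc_log_add_exp2 ab; rewrite E trunc_log_add_exp2 // => M.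
have inj x y : 2 ^ x = 2 ^ y -> x = y by move/eqP; rewrite eqn_exp2l // => /eqP.
have [F|[F|[F|F]]] : b = d \/ b = c \/ a = c \/ a = d by lia.
- by left; split=> //; apply: inj; move: E; rewrite F => /addIn.
- by right; split=> //; apply: inj; move: E; rewrite F addnC => /addnI.
- by left; split=> //; apply: inj; move: E; rewrite F => /addnI.
- by right; split=> //; apply: inj; move: E; rewrite F addnC => /addIn.
Qed.


(** * Counting edges by degrees *)

Lemma card_unordered_pairs (T : finType) (R : rel T) :
  symmetric R -> irreflexive R ->
  2 * #|[set [set p.1; p.2] | p : T * T & R p.1 p.2]| = \sum_x \sum_y R x y.
Proof.
move=> Rsym Rirr; pose h (p : T * T) := [set p.1; p.2].
have -> : [set [set p.1; p.2] | p : T * T & R p.1 p.2] = h @: [set p | R p.1 p.2].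
  by apply/setP => e; apply/imsetP/imsetP => -[p]; rewrite !inE => Rp ->;
    exists p; rewrite ?inE.
rewrite pair_big /= [RHS](_ : _ = \sum_(p in [set p : T * T | R p.1 p.2]) 1); last first.
  rewrite [RHS]big_mkcond /=; apply: eq_bigr => p _.
  by rewrite inE; case: (R _ _).
(* The ordered pairs are grouped by the edge they span; each fibre is [[set (x, y); (y, x)]], of
   size two by irreflexivity. *)
rewrite (partition_big_imset h) /= mulnC -sum_nat_const.
apply: eq_bigr => e /imsetP[[x y]]; rewrite inE /= => Rxy ->.
have xy : x != y by apply: contraTneq Rxy => ->; rewrite Rirr.
rewrite -[LHS](_ : #|[set (x, y); (y, x)]| = 2); last first.
  by rewrite cards2 xpair_eqE negb_and xy.
rewrite -sum1_card; apply: eq_bigl => -[a b]; rewrite !inE !xpair_eqE /h /=.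
apply/idP/idP => [/orP[]/andP[/eqP-> /eqP->] | /andP[Rab /eqP eqab]].
- by rewrite Rxy eqxx.
- by rewrite Rsym Rxy setUC eqxx.
have ab : a != b by apply: contraTneq Rab => ->; rewrite Rirr.
have : a \in [set x; y] by rewrite -eqab !inE eqxx.
have : b \in [set x; y] by rewrite -eqab !inE eqxx orbT.
by move: ab; rewrite !inE => ab /pred2P[] E /pred2P[] E'; move: ab; rewrite E E' ?eqxx ?orbT.
Qed.

Definition deg (G : sgraph) (x : G) := \sum_(y : G) adj x y.

Definition independent (G : sgraph) (I : {set G}) :=
  forall x y, x \in I -> y \in I -> ~~ adj x y.

(** An edge meeting the independent set [I] has exactly one end in it, so the degree sum over [I]
    counts each such edge once. Everything is doubled to match the handshake count of ordered
    pairs. *)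
Lemma card_edges_avoiding (G : sgraph) (I : {set G}) : independent I ->
  2 * #|[set [set p.1; p.2] | p : G * G &
           [&& adj p.1 p.2, p.1 \notin I & p.2 \notin I]]|
    + 2 * \sum_(x in I) deg x = \sum_(x : G) deg x.
Proof.
move=> indI; pose R := [rel x y : G | [&& adj x y, x \notin I & y \notin I]].
rewrite (@card_unordered_pairs _ R); last 2 first.
- by move=> x y; rewrite /R /= adj_sym [_ && (y \notin I)]andbC.
- by move=> x; rewrite /R /= adj_irrefl.
have -> : \sum_(x in I) deg x = \sum_(x : G) \sum_(y : G) (adj x y && (x \in I)).
  rewrite big_mkcond; apply: eq_bigr => x _; case: (x \in I).
    by apply: eq_bigr => y _; rewrite andbT.
  by rewrite big1 // => y _; rewrite andbF.
(* One copy of the sum over [I] is transposed, so that an ordered pair is counted once for its first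
   end in [I] and once for its second; the identity then holds pair by pair. *)
rewrite mul2n -addnn [X in _ + (_ + X)]exchange_big /= -!big_split /=; apply: eq_bigr => x _.
rewrite -!big_split /=; apply: eq_bigr => y _; rewrite [adj y x]adj_sym.
have := indI x y; case: (x \in I) (y \in I) (adj x y) => [] [] [] //=.
by move=> /(_ isT isT).
Qed.

(** * Weak IASIs and independent sets *)

Definition poly_indexed (G : sgraph) (f : G -> {fset nat}) : {set G} :=
  [set x | #|` f x| != 1].

Lemma poly_indexed_independent (G : sgraph) (f : G -> {fset nat}) :
  is_weak_IASI f -> independent (poly_indexed f).
Proof.
move=> [[f0 _ _] weakf] x y; rewrite !inE => fx fy; apply/negP => /weakf E.
have := @card_sumset_gt_max (f x) (f y); rewrite E ltnn.
have := f0 x; have := f0 y; rewrite -!cardfs_gt0; lia.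
Qed.

(** By weakness an edge label has the larger of the two end sizes, which is 1 exactly when both ends
    are singletons. *)
Lemma mono_edgesE (G : sgraph) (f : G -> {fset nat}) : is_weak_IASI f ->
  mono_edges f = [set [set p.1; p.2] | p : G * G &
    [&& adj p.1 p.2, p.1 \notin poly_indexed f & p.2 \notin poly_indexed f]].
Proof.
move=> [[f0 _ _] weakf].
have E (p : G * G) : adj p.1 p.2 && (#|` sumset (f p.1) (f p.2)| == 1) =
    [&& adj p.1 p.2, p.1 \notin poly_indexed f & p.2 \notin poly_indexed f].
  case: p => x y /=; case: (boolP (adj x y)) => //= /weakf ->; rewrite !inE.
  have := f0 x; have := f0 y; rewrite -!cardfs_gt0; lia.
by apply/setP => e; apply/imsetP/imsetP => -[p]; rewrite !inE => Rp ->;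
  exists p => //; rewrite inE; move: Rp; rewrite E !inE.
Qed.

Section Labelling.
Variables (G : sgraph) (I : {set G}).

Let pow (x : G) := 2 ^ enum_rank x.

(** Each label has its own power of two as least element. Outside [I] it is a singleton, so adding
    it only translates the other label and weakness holds on every edge with an end outside [I]. *)
Definition labelling (x : G) : {fset nat} :=
  if x \in I then [fset pow x; (pow x).+1] else [fset pow x].

Let pow_in x : pow x \in labelling x.
Proof. by rewrite /labelling; case: ifP; rewrite !inE eqxx. Qed.

Let pow_le x a : a \in labelling x -> pow x <= a.
Proof. by rewrite /labelling; case: ifP; rewrite !inE; lia. Qed.

Let pow_inj : injective pow.
Proof. by move=> x y /eqP; rewrite eqn_exp2l // => /eqP/val_inj/enum_rank_inj. Qed.

Lemma card_labelling x : #|` labelling x| = (x \in I).+1.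
Proof.
rewrite /labelling; case: ifP => _; last by rewrite cardfs1.
by rewrite cardfs2 neq_ltn ltnSn.
Qed.

Let card_sumset1l b (A : {fset nat}) : #|` sumset [fset b] A| = #|` A|.
Proof. by rewrite sumsetC sumset1r card_translate. Qed.

(* The least element [2 ^ i + 2 ^ j] of an edge label determines the edge. *)
Lemma labelling_weak_IASI : independent I -> is_weak_IASI labelling.
Proof.
move=> indI; split; first split.
- by move=> x; apply/fset0Pn; exists (pow x).
- move=> x y E; apply: pow_inj; apply/eqP; rewrite eqn_leq.
  by rewrite pow_le ?E ?pow_in // -[X in _ <= X]/(pow x) pow_le // -E pow_in.
- have least x y x' y' : sumset (labelling x) (labelling y)
      = sumset (labelling x') (labelling y') -> pow x' + pow y' <= pow x + pow y.
    move=> E; have : pow x + pow y \in sumset (labelling x) (labelling y).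
      by apply/in_sumset; exists (pow x), (pow y).
    by rewrite E => /in_sumset[a [b [/pow_le xa /pow_le yb ->]]]; rewrite leq_add.
  have neq x y : adj x y -> enum_rank x != enum_rank y :> nat.
    move=> xy; rewrite (inj_eq val_inj) (inj_eq enum_rank_inj).
    by apply: contraTneq xy => ->; rewrite adj_irrefl.
  move=> x y x' y' /neq xy /neq xy' E.
  have : pow x + pow y = pow x' + pow y'.
    by apply/eqP; rewrite eqn_leq !least.
  case/(sum_exp2_inj xy xy') => -[/val_inj/enum_rank_inj-> /val_inj/enum_rank_inj->] //.
  by rewrite setUC.
- move=> x y xy; rewrite !card_labelling.
  have := indI x y; case: (boolP (x \in I)) => xI; case: (boolP (y \in I)) => yI H.
  + by have := H isT isT; rewrite xy.
  + by rewrite {2}/labelling (negPf yI) sumset1r card_translate card_labelling xI.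
  + by rewrite {1}/labelling (negPf xI) card_sumset1l card_labelling yI.
  + by rewrite {1}/labelling (negPf xI) card_sumset1l card_labelling (negPf yI).
Qed.

Lemma poly_indexed_labelling : poly_indexed labelling = I.
Proof. by apply/setP => x; rewrite inE card_labelling; case: (x \in I). Qed.

End Labelling.

(** Turns the sparing number into the maximisation of the degree sum over independent sets; labels
    no longer occur in the hypotheses. *)
Lemma sparing_numberP (G : sgraph) k :
  (exists I : {set G}, independent I /\
     2 * k + 2 * \sum_(x in I) deg x = \sum_(x : G) deg x) ->
  (forall I : {set G}, independent I ->
     2 * k + 2 * \sum_(x in I) deg x <= \sum_(x : G) deg x) ->
  is_sparing_number G k.
Proof.
have key (f : G -> {fset nat}) (wf : is_weak_IASI f) :
    2 * #|mono_edges f| + 2 * \sum_(x in poly_indexed f) deg x = \sum_(x : G) deg x.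
  by rewrite mono_edgesE // card_edges_avoiding //; apply: poly_indexed_independent.
case=> [I [indI eqk]] lek; split.
  exists (labelling I); have wI := labelling_weak_IASI indI; split=> //.
  by have := key _ wI; rewrite poly_indexed_labelling -eqk; lia.
move=> f wf; have := lek _ (poly_indexed_independent wf); rewrite -(key f wf); by rewrite leq_add2r leq_pmul2l.
Qed.

(** * Adjacency and degrees in the square of a complete sun *)

Lemma square_adjE (G : sgraph) (x y : G) :
  square_adj x y = (x != y) && (adj x y || [exists z, adj x z && adj z y]).
Proof.
have walk0 : walk x y 0 = (x == y).
  apply/existsP/idP => [[p]|E]; first by rewrite (tuple0 p).
  by exists [tuple].
have walk1 : walk x y 1 = adj x y.
  apply/existsP/idP => [[[[|a []] //= i]]|xy]; last by exists [tuple y]; rewrite /= xy eqxx.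
  by rewrite andbT => /andP[xa /eqP <-].
have walk2 : walk x y 2 = [exists z, adj x z && adj z y].
  apply/existsP/existsP => [[[[|a [|b []]] //= i]]|[z xzy]].
    by rewrite andbT => /andP[/andP[xa ab] /eqP <-]; exists a; rewrite xa.
  by exists [tuple z; y]; rewrite /= andbT eqxx andbT.
rewrite /square_adj /=; case: eqVneq => //= xy.
apply/existsP/orP => [[[[|[|[|]]] //= i]] | ].
- by rewrite /is_dist /= walk0 (negPf xy).
- by rewrite /is_dist /= walk1 => /andP[]; left.
- by rewrite /is_dist /= walk2 => /andP[]; right.
case: (boolP (adj x y)) => [axy _ | naxy [//|ex2]].
  exists (@Ordinal 3 1 isT); rewrite /is_dist /= walk1 axy.
  by apply/forallP => -[[] //= i]; rewrite walk0 xy.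
exists (@Ordinal 3 2 isT); rewrite /is_dist /= walk2 ex2.
by apply/forallP => -[[|[]] //= i]; rewrite ?walk0 ?xy // walk1.
Qed.

Section CompleteSun.
Variables (n : nat) (G : sgraph) (u w : 'I_n -> G).
Hypotheses (sun : is_sun u w) (complete : forall i j, i != j -> adj (u i) (u j)).

Let n3 : 3 <= n. Proof. exact: sun_order_ge3 sun. Qed.

Lemma adj_wu i j : adj (w j) (u i) = (j == i) || (j == ordS i).
Proof.
rewrite (sun_adj sun); congr (_ || _).
by rewrite -val_eqE /= [j %% n]modn_small.
Qed.

Lemma neq_ordS (i : 'I_n) : i != ordS i.
Proof.
rewrite -val_eqE /=; have lt_in := ltn_ord i.
have [lt|ge] := ltnP i.+1 n; first by rewrite modn_small //; lia.
have -> : i.+1 = n by lia.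
by rewrite modnn; lia.
Qed.

Lemma ordS2_neq (i : 'I_n) : ordS (ordS i) != i.
Proof.
rewrite -val_eqE /= -addn1 modnDml addn1.
have := ltn_ord i; have [lt|] := ltnP i.+2 n; first by rewrite modn_small //; lia.
move=> ge lt; rewrite -(subnK ge) modnDr modn_small; lia.
Qed.

Lemma square_uu i j : adj (u i : square G) (u j) = (i != j).
Proof.
rewrite [LHS]square_adjE (inj_eq (sun_inj_u sun)).
by case: eqVneq => //= ij; rewrite complete.
Qed.

Lemma square_wu i j : adj (w j : square G) (u i).
Proof.
rewrite -[adj _ _]/(square_adj (w j) (u i)) square_adjE eq_sym (sun_disjoint sun) /= adj_wu.
(* When [w j] and [u i] are not matched, [u j] is a common neighbour, as the [u i] form a clique. *)
case: eqVneq => //= ji; apply/orP; right; apply/existsP; exists (u j).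
by rewrite adj_wu eqxx complete.
Qed.

Lemma square_uw i j : adj (u i : square G) (w j).
Proof. by rewrite adj_sym square_wu. Qed.

(** Vertices of the independent set [W] can only be joined through a common neighbour [u k], whose
    neighbours in [W] are [w k] and [w (ordS k)]. *)
Lemma square_ww i j : adj (w i : square G) (w j) = (j == ordS i) || (i == ordS j).
Proof.
rewrite [LHS]square_adjE (inj_eq (sun_inj_w sun)) (negPf (sun_independent sun i j)) /=.
apply/andP/idP => [[ij /existsP[z]]|].
  have [[k ->]|[k ->]] := sun_cover sun z; last by rewrite (negPf (sun_independent sun i k)).
  rewrite [adj (u k) _]adj_sym !adj_wu => /andP[/pred2P[] iE /pred2P[] jE];
    by move: ij; rewrite iE jE ?eqxx ?orbT.
case/orP => /eqP E; rewrite E ?[ordS _ == _]eq_sym neq_ordS; split=> //; apply/existsP.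
- by exists (u i); rewrite [adj (u i) _]adj_sym !adj_wu !eqxx orbT.
- by exists (u j); rewrite [adj (u j) _]adj_sym !adj_wu !eqxx orbT.
Qed.

Lemma sun_sum (F : G -> nat) : \sum_x F x = \sum_i F (u i) + \sum_j F (w j).
Proof.
have disj j : w j \notin [set u i | i : 'I_n].
  by apply/imsetP => -[i _ /eqP]; rewrite eq_sym (negPf (sun_disjoint sun i j)).
rewrite (bigID (mem [set u i | i : 'I_n])) /= big_imset /=; last first.
  by move=> i j _ _; apply: (sun_inj_u sun).
congr (_ + _); rewrite (eq_bigl (mem [set w j | j : 'I_n])) => [|x].
  by rewrite big_imset //= => i j _ _; apply: (sun_inj_w sun).
have [[i ->]|[j ->]] := sun_cover sun x.
  rewrite imset_f //=; apply/esym/negbTE/imsetP => -[j _ /eqP].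
  by rewrite (negPf (sun_disjoint sun i j)).
by rewrite disj [RHS]imset_f.
Qed.

Lemma deg_square_u i : deg (u i : square G) = n.*2.-1.
Proof.
rewrite /deg sun_sum.
under eq_bigr do rewrite square_uu.
under [X in _ + X]eq_bigr do rewrite square_uw.
rewrite sum_nat_const card_ord muln1.
rewrite (bigD1 i) //= eqxx (eq_bigr (fun=> 1)) => [|j]; last by rewrite eq_sym => ->.
rewrite sum1dep_card (_ : finset _ = [set~ i]) ?cardsC1 ?card_ord; first by lia.
by apply/setP => j; rewrite !inE.
Qed.

Lemma deg_square_w j : deg (w j : square G) = n.+2.
Proof.
rewrite /deg sun_sum.
under eq_bigr do rewrite square_wu.
under [X in _ + X]eq_bigr do rewrite square_ww.
rewrite sum_nat_const card_ord muln1 -addn2; congr (_ + _).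
(* The neighbours of [w j] in [W] are its two cyclic neighbours, distinct by [ordS2_neq]. *)
have <- : #|[set ordS j; ord_pred j]| = 2.
  by rewrite cards2 -(inj_eq (@ordS_inj n)) ord_predK ordS2_neq.
rewrite -sum1_card [RHS]big_mkcond; apply: eq_bigr => k _.
rewrite !inE -(inj_eq (@ordS_inj n) k (ord_pred j)) ord_predK [ordS k == _]eq_sym.
by case: (_ || _).
Qed.

Lemma sum_deg_square : \sum_(x : square G) deg x = n * n.*2.-1 + n * n.+2.
Proof.
rewrite sun_sum; under eq_bigr do rewrite deg_square_u.
by under [X in _ + X]eq_bigr do rewrite deg_square_w; rewrite !sum_nat_const card_ord.
Qed.

Lemma sum_deg_image_w (J : {set 'I_n}) :
  \sum_(x in w @: J) deg (x : square G) = #|J| * n.+2.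
Proof.
rewrite big_imset /=; last by move=> i j _ _; apply: (sun_inj_w sun).
by under eq_bigr do rewrite deg_square_w; rewrite sum_nat_const.
Qed.

(** * Optimal independent sets and the resulting count *)

Lemma card_cyclic_independent (J : {set 'I_n}) :
  {in J, forall j, ordS j \notin J} -> #|J| <= n./2.
Proof.
(* [J] and its cyclic shift are disjoint and equal in size, so twice [#|J|] is at most [n]. *)
move=> indJ; have : #|J :|: @ordS n @: J| <= n by rewrite -[n in X in _ <= X]card_ord max_card.
rewrite cardsU disjoint_setI0 ?cards0 ?card_imset.
- by rewrite subn0 addnn => /half_leq; rewrite doubleK.
- exact: ordS_inj.
- rewrite disjoint_sym disjoints_subset; apply/subsetP => _ /imsetP[j jJ ->].
  by rewrite inE indJ.
Qed.

Lemma sum_deg_independent (I : {set square G}) : independent I ->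
  \sum_(x in I) deg x <= n./2 * n.+2.
Proof.
move=> indI; case: (boolP [exists i, u i \in I]) => [/existsP[i uI] | noU].
  (* In the square [u i] is adjacent to every other vertex, so it leaves no room for a second
     element. *)
  have -> : I = [set u i].
    apply/setP => x; rewrite inE; apply/idP/eqP => [xI | -> //].
    have [[j E]|[j E]] := sun_cover sun x; have := indI _ _ uI xI; rewrite E.
      by rewrite square_uu negbK => /eqP ->.
    by rewrite square_uw.
  (* What remains is [n.*2.-1 <= n./2 * n.+2], an equality at [n = 3]. *)
  rewrite big_set1 deg_square_u; have := odd_double_half n; have := n3.
  by case: (odd n); nia.
have -> : I = w @: [set j | w j \in I].
  apply/setP => x; apply/idP/imsetP => [xI | [j]]; last by rewrite inE => jI ->.
  have [[i E]|[j E]] := sun_cover sun x; last by exists j; rewrite // inE -E.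
  by case/existsP: noU; exists i; rewrite -E.
rewrite sum_deg_image_w leq_mul2r card_cyclic_independent ?orbT // => j.
rewrite !inE => jI; apply/negP => /(indI _ _ jI).
by rewrite square_ww eqxx.
Qed.

(** Odd indices are chosen because indices start at 0: the wrap-around successor of [n - 1] is 0,
    which is even, so no parity assumption on [n] arises. *)
Lemma independent_odd_w : independent (w @: [set j : 'I_n | odd j] : {set square G}).
Proof.
move=> x y /imsetP[i]; rewrite inE => oi -> /imsetP[j]; rewrite inE => oj ->.
have nS (a b : 'I_n) : odd a -> odd b -> a != ordS b.
  move=> oa ob; apply: contraTneq oa => ->; rewrite /=.
  have [lt|] := ltnP b.+1 n; first by rewrite modn_small //= ob.
  have := ltn_ord b => lt ge.
  have -> : b.+1 = n by lia.
  by rewrite modnn.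
by rewrite square_ww (negPf (nS _ _ oi oj)) (negPf (nS _ _ oj oi)).
Qed.

End CompleteSun.

Lemma card_odd_ord n : #|[set j : 'I_n | odd j]| = n./2.
Proof.
rewrite -sum1dep_card big_mkcond.
elim: n => [|n IH]; first by rewrite big_ord0.
by rewrite big_ord_recr /= IH uphalf_half addnC; case: (odd n).
Qed.

Theorem theorem2p9 (n : nat) (hn : 3 <= n) (G : sgraph)
    (hG : complete_sun n G) :
  is_sparing_number (square G)
    (if odd n then n ^ 2 + 1 else n./2 * (2 * n - 1)).
Proof.
case: hG => u [w [sun complete]].
(* For even [n] the terms [n * n.+2] cancel and [n * (2 * n - 1)] is left; for odd [n] one further
   [n.+2] survives, giving [2 * (n ^ 2 + 1)]. *)
have count : 2 * (if odd n then n ^ 2 + 1 else n./2 * (2 * n - 1)) +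
    2 * (n./2 * n.+2) = \sum_(x : square G) deg x.
  rewrite (sum_deg_square sun complete).
  have E := odd_double_half n; rewrite -muln2 in E; case: (odd n) E => /= E; nia.
apply: sparing_numberP => [|I indI].
  exists (w @: [set j : 'I_n | odd j]); split; first exact: (independent_odd_w sun).
  by rewrite (sum_deg_image_w sun complete) card_odd_ord.
by rewrite -count leq_add2l leq_pmul2l // (sum_deg_independent sun complete).
Qed.
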